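(* Let $X\subseteq\mathbb C^n$ be an irreducible curve. (I) If $X$ is not contained in any hypersphere, then $\Sigma_X^\infty=\emptyset$. (II) Otherwise, let $c$ be the center of a hypersphere containing $X$, let $V$ be the smallest affine linear subspace of $\mathbb C^n$ containing $X$, and let $N\,V=\{y\in\mathbb C^n: y\cdot(v-v')=0\ \forall v,v'\in V\}$ be its normal space. Then $\Sigma_X^\infty=\{c+y:y\in N\,V\}$.
   Context: For $x,y\in\mathbb C^n$, $x\cdot y=\sum x_iy_i$ (complex bilinear). A hypersphere centered at $c$ is a set $\{x:(x-c)\cdot(x-c)=r\}$ for some $r\in\mathbb C$ ($r=0$ allowed). For $x\in X_{\mathrm{reg}}$ (smooth locus), $N_xX$ is the span of gradients at $x$ of generators of the ideal of $X$. The ED correspondence $\mathcal E_X$ is the Zariski closure of $\{(x,u):x\in X_{\mathrm{reg}},u-x\in N_xX\}$, $\mathcal E_X(u)=\{x:(x,u)\in\mathcal E_X\}$, and $\Sigma_X^\infty=\{u:\dim\mathcal E_X(u)\ge1\}$. *)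

(* Defs.v *)
From HB Require Import structures.
From mathcomp Require Import all_boot all_order all_algebra.
From mathcomp Require Import mpoly complex.
From mathcomp Require reals.

Set Implicit Arguments.
Unset Strict Implicit.
Unset Printing Implicit Defensive.

Import Order.TTheory GRing.Theory Num.Theory.
Local Open Scope ring_scope.

Section Defs.

Variable K : fieldType.

Definition pt (m : nat) := 'rV[K]_m.

Definition peval (m : nat) (p : {mpoly K[m]}) (x : pt m) : K :=
  p.@[fun i => x ord0 i].

Definition zero_set (m : nat) (S : {mpoly K[m]} -> Prop) : pt m -> Prop :=
  fun x => forall p, S p -> peval p x = 0.

Definition vanishing (m : nat) (X : pt m -> Prop) : {mpoly K[m]} -> Prop :=
  fun p => forall x, X x -> peval p x = 0.

Definition subset_of (m : nat) (A B : pt m -> Prop) := forall x, A x -> B x.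

Definition zclosed (m : nat) (X : pt m -> Prop) :=
  exists S : {mpoly K[m]} -> Prop, forall x, X x <-> zero_set S x.

Definition zclosure (m : nat) (X : pt m -> Prop) : pt m -> Prop :=
  zero_set (vanishing X).

Definition irreducible (m : nat) (X : pt m -> Prop) :=
  [/\ zclosed X, exists x, X x &
     forall Y Z : pt m -> Prop, zclosed Y -> zclosed Z ->
       subset_of X (fun x => Y x \/ Z x) -> subset_of X Y \/ subset_of X Z].

(* X contains a strictly increasing chain Z_0 < Z_1 < ... < Z_k of
   irreducible closed subsets, i.e. dim X >= k (Krull dimension) *)
Definition has_chain (m : nat) (X : pt m -> Prop) (k : nat) :=
  exists Z : nat -> pt m -> Prop,
    (forall i, (i <= k)%N -> irreducible (Z i) /\ subset_of (Z i) X) /\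
    (forall i, (i < k)%N ->
       subset_of (Z i) (Z i.+1) /\ exists x, Z i.+1 x /\ ~ Z i x).

Definition has_dim (m : nat) (X : pt m -> Prop) (d : nat) :=
  has_chain X d /\ ~ has_chain X d.+1.

Definition irreducible_curve (n : nat) (X : pt n -> Prop) :=
  irreducible X /\ has_dim X 1.

Definition grad (n : nat) (p : {mpoly K[n]}) (x : pt n) : 'rV[K]_n :=
  \row_i peval (p^`M(i)) x.

Definition jac (n k : nat) (ps : 'I_k -> {mpoly K[n]}) (x : pt n) : 'M[K]_(k, n) :=
  \matrix_(j < k) grad (ps j) x.

(* N_x X: span of gradients at x of the polynomials of the ideal I(X)
   (equivalently, of any generating set of I(X)) *)
Definition normal_at (n : nat) (X : pt n -> Prop) (x : pt n) : 'rV[K]_n -> Prop :=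
  fun y => exists k (ps : 'I_k -> {mpoly K[n]}),
    (forall j, vanishing X (ps j)) /\ (y <= jac ps x)%MS.

(* smooth points: x in X with dim N_x X = n - dim X *)
Definition regular_pt (n : nat) (X : pt n -> Prop) (x : pt n) :=
  X x /\ exists d, has_dim X d /\
    (exists k (ps : 'I_k -> {mpoly K[n]}),
        (forall j, vanishing X (ps j)) /\ \rank (jac ps x) = (n - d)%N) /\
    (forall k (ps : 'I_k -> {mpoly K[n]}),
        (forall j, vanishing X (ps j)) -> (\rank (jac ps x) <= n - d)%N).

Definition ED_corr (n : nat) (X : pt n -> Prop) : pt (n + n) -> Prop :=
  zclosure (fun z => exists x u : pt n,
    z = row_mx x u /\ regular_pt X x /\ normal_at X x (u - x)).

Definition ED_fiber (n : nat) (X : pt n -> Prop) (u : pt n) : pt n -> Prop :=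
  fun x => ED_corr X (row_mx x u).

Definition Sigma_inf (n : nat) (X : pt n -> Prop) : pt n -> Prop :=
  fun u => has_chain (ED_fiber X u) 1.

Definition dotp (n : nat) (x y : pt n) : K := \sum_(i < n) x ord0 i * y ord0 i.

Definition in_hypersphere (n : nat) (X : pt n -> Prop) (c : pt n) (r : K) :=
  forall x, X x -> dotp (x - c) (x - c) = r.

(* affine subspaces (possibly empty): closed under affine combinations *)
Definition affine_subspace (n : nat) (A : pt n -> Prop) :=
  forall (k : nat) (v : 'I_k -> pt n) (t : 'I_k -> K),
    (forall j, A (v j)) -> \sum_j t j = 1 -> A (\sum_j t j *: v j).

Definition affine_hull (n : nat) (X : pt n -> Prop) : pt n -> Prop :=
  fun v => forall A, affine_subspace A -> subset_of X A -> A v.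

Definition normal_space (n : nat) (V : pt n -> Prop) : pt n -> Prop :=
  fun y => forall v v', V v -> V v' -> dotp y (v - v') = 0.

End Defs.

(* Main.v *)
Require Import Defs.
From HB Require Import structures.
From mathcomp Require Import all_boot all_order all_algebra.
From mathcomp Require Import mpoly complex.
From mathcomp Require reals.
Import reals.Real.Exports.
From mathcomp Require Import ring.
From Stdlib Require Import Classical ClassicalEpsilon.
Set Implicit Arguments.
Unset Strict Implicit.
Unset Printing Implicit Defensive.
Import Order.TTheory GRing.Theory Num.Theory.
Local Open Scope ring_scope.

(* Let I be the ideal of X, and f_u(x) = (x - u).(x - u), whose gradient is
   2(x - u). The claim reduces to: u lies in Sigma_X^oo iff f_u is constant on
   X, because two centers u, c of hyperspheres through X differ by a vector
   y with y.x constant on X.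
   If the fiber over u contains a chain, it is all of X, since dim X = 1; so
   grad f_u is normal to X at the generic point. Suppose f = f_u is not
   constant on X. Each coordinate x_j is algebraic over f modulo I: there is Q_j
   with Q_j(f, x_j) in I and, for Q_j of minimal degree in x_j, with
   (d_2 Q_j)(f, x_j) not in I. The gradient of Q_j(f, x_j) is a nonzero multiple
   of e_j modulo grad f, hence every e_j would be normal to X at a generic
   point, which is impossible: n polynomials of I with invertible Jacobian at
   a point isolate that point. The same construction with f a nonconstant
   coordinate shows that regular points are dense in X, which gives the
   converse.
   Algebraic dependence comes from the Krull dimension: by noetherianity every
   infinite closed set contains an infinite irreducible one, so a polynomial
   outside I has finitely many zeros on X, whereas if f and g were
   algebraically independent modulo I, almost all points of the plane would
   lift to X along (f, g), and some {f = c} would be infinite. *)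

(** * Minimal elements, ideals and generation of algebras *)

Lemma ex_minimal (T : Type) (f : T -> nat) (P : T -> Prop) :
  (exists x, P x) -> exists x, P x /\ forall y, P y -> (f x <= f y)%N.
Proof.
move=> [x]; have [k] := ubnP (f x); elim: k x => // k IHk x ltfk Px.
case: (classic (exists y, P y /\ (f y < f x)%N)) => [[y [Py lty]]|no].
  by apply: (IHk y) => //; exact: leq_trans lty _.
exists x; split=> // y Py; rewrite leqNgt; apply/negP => lty.
by apply: no; exists y.
Qed.

Definition ideal (A : comNzRingType) (J : A -> Prop) :=
  [/\ J 0, forall a b, J a -> J b -> J (a + b) & forall a b, J b -> J (a * b)].

Definition prime_ideal (A : comNzRingType) (J : A -> Prop) :=
  [/\ ideal J, ~ J 1 & forall a b, J (a * b) -> J a \/ J b].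

(** [A] is generated by [xs] as an algebra over the image of [io]. The form of an induction
    principle lets it be applied directly to a property of elements. *)
Definition generates (B A : comNzRingType) (io : B -> A) (xs : seq A) :=
  forall S : A -> Prop, (forall b, S (io b)) -> (forall x, x \in xs -> S x) ->
    (forall a b, S a -> S b -> S (a + b)) ->
    (forall a b, S a -> S b -> S (a * b)) -> forall a, S a.

Section Generation.

Variables (B A : comNzRingType) (io : {rmorphism B -> A}).

Definition adjoin_morph (x : A) : {rmorphism {poly B} -> A} :=
  horner_morph (fun b => mulrC x (io b)).

Lemma adjoin_morphC x b : adjoin_morph x b%:P = io b.
Proof. exact: horner_morphC. Qed.

Lemma adjoin_morphX x : adjoin_morph x 'X = x.
Proof. exact: horner_morphX. Qed.

Lemma generates_nil : generates io [::] -> forall a, exists b, io b = a.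
Proof.
apply=> [b|//|_ _ [b <-] [c <-]|_ _ [b <-] [c <-]]; first by exists b.
  by exists (b + c); rewrite rmorphD.
by exists (b * c); rewrite rmorphM.
Qed.

(** Moves one generator into the base ring, which becomes [{poly B}]; inductions on [xs] therefore
    generalize over the base. *)
Lemma generates_cons x xs :
  generates io (x :: xs) -> generates (adjoin_morph x) xs.
Proof.
move=> gen S Sio Sxs SD SM; apply: gen => // [b|y].
  by rewrite -(adjoin_morphC x); apply: Sio.
rewrite inE => /predU1P[->|]; last exact: Sxs.
by rewrite -[x]adjoin_morphX; apply: Sio.
Qed.

Lemma ideal_preim (J : A -> Prop) : ideal J -> ideal (fun b => J (io b)).
Proof.
case=> J0 JD JM; split=> [|a b|a b]; rewrite ?rmorph0 ?rmorphD ?rmorphM //.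
  exact: JD.
exact: JM.
Qed.

Lemma prime_ideal_preim (J : A -> Prop) :
  prime_ideal J -> prime_ideal (fun b => J (io b)).
Proof.
case=> idJ J1 prJ; split; first exact: ideal_preim.
  by rewrite rmorph1.
by move=> a b; rewrite rmorphM; apply: prJ.
Qed.

End Generation.

Lemma idealB (A : comNzRingType) (J : A -> Prop) a b :
  ideal J -> J a -> J b -> J (a - b).
Proof. by case=> _ JD JM Ja Jb; apply: JD => //; rewrite -mulN1r; apply: JM. Qed.

(** * Noetherian rings *)

(** The chain condition for sequences: some term lies in the ideal generated by its predecessors,
    that ideal being described through all ideals [J] containing them. *)
Definition noetherian (A : comNzRingType) := forall a : nat -> A,
  exists N, forall J, ideal J -> (forall k, (k < N)%N -> J (a k)) -> J (a N).

Lemma noetherian_field (K : fieldType) : noetherian K.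
Proof.
move=> a; have [a0|a0] := eqVneq (a 0) 0.
  by exists 0 => J [J0 _ _] _; rewrite a0.
by exists 1 => J [_ _ JM] Ja; rewrite -(divfK a0 (a 1)); apply/JM/Ja.
Qed.

Lemma noetherian_surj (B A : comNzRingType) (io : {rmorphism B -> A}) :
  (forall a, exists b, io b = a) -> noetherian B -> noetherian A.
Proof.
move=> surj noethB a.
have [b bE] := choice _ (fun k => surj (a k)).
have [N HN] := noethB b; exists N => J idJ Ja.
rewrite -bE; apply: (HN _ (ideal_preim io idJ)) => k ltk /=.
by rewrite bE; apply: Ja.
Qed.

(* Hilbert's basis theorem: pick p_k of minimal size in the ideal I but outside
   the span of p_0, ..., p_(k-1); a relation among leading coefficients
   contradicts minimality. *)
Lemma noetherian_poly (B : comNzRingType) : noetherian B -> noetherian {poly B}.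
Proof.
move=> noethB a; apply: NNPP => /not_ex_all_not notN.
pose span (s : seq {poly B}) p :=
  forall J, ideal J -> (forall q, q \in s -> J q) -> J p.
pose I p := exists M, forall J, ideal J -> (forall k, (k < M)%N -> J (a k)) -> J p.
have idspan s : ideal (span s).
  split=> [|p q Ip Iq|p q Iq] J idJ Js; case: (idJ) => J0 JD JM; first by [].

    by apply: JD; [apply: Ip | apply: Iq].
  by apply: JM; apply: Iq.
have idI : ideal I.
  split=> [|p q [M IM] [M' IM']|p q [M IM]].
  - by exists 0 => J [].
  - exists (maxn M M') => J idJ Ja; case: (idJ) => _ JD _.
    by apply: JD; [apply: IM | apply: IM'] => // k ltk; apply: Ja;
      rewrite leq_max ltk ?orbT.
  - by exists M => J idJ Ja; case: (idJ) => _ _ JM; apply: JM; apply: IM.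
(* The premise on [s] sits under the existential so that [choice] gives a total function [F]. *)
have next s : exists p, (forall q, q \in s -> I q) ->
    [/\ I p, ~ span s p &
      forall q, I q -> ~ span s q -> (size p <= size q)%N].
  case: (classic (forall q, q \in s -> I q)) => [Is|nIs]; last by exists 0.
  have [|p [[Ip nsp] minp]] :=
    @ex_minimal _ (fun p : {poly B} => size p) (fun p => I p /\ ~ span s p).
    (* With a bound [M] valid for all of [s], the term [a M] is in [I] but not in the span of [s],
       since [notN] holds at [M]. *)
    have [M IM] : exists M, forall J, ideal J ->
        (forall k, (k < M)%N -> J (a k)) -> forall q, q \in s -> J q.
      elim: s Is => [|q s IHs] Is; first by exists 0.
      have [|M IM] := IHs; first by move=> r rs; apply: Is; rewrite inE rs orbT.
      have [|M' IM'] := Is q; first by rewrite inE eqxx.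
      exists (maxn M M') => J idJ Ja r.
      rewrite inE => /predU1P[->|rs]; [apply: IM'|apply: (IM J)] => // k ltk;
        by apply: Ja; rewrite leq_max ltk ?orbT.
    exists (a M); split.
      by exists M.+1 => J _; apply.
    move=> spM; apply: (notN M) => J idJ Ja; apply: spM => // q qs.
    exact: IM qs.
  by exists p => _; split=> // q Iq nsq; apply: minp.
have [F HF] := choice _ next.
pose s := fix s k := if k is k'.+1 then rcons (s k') (F (s k')) else [::].
have sI k : forall q, q \in s k -> I q.
  elim: k => // k IHk q /=; rewrite mem_rcons inE => /predU1P[->|]; last exact: IHk.
  by have [] := HF _ IHk.
have sub_s j k : (j <= k)%N -> {subset s j <= s k}.
  elim: k => [|k IHk]; first by rewrite leqn0 => /eqP->.
  rewrite leq_eqVlt => /predU1P[->//|/IHk sjk q qj].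
  by rewrite /= mem_rcons inE sjk ?orbT.
pose p k := F (s k).
have ps j k : (j < k)%N -> p j \in s k.
  by move=> ltjk; apply: (sub_s _ _ ltjk); rewrite /= mem_rcons inE eqxx.
have [N HN] := noethB (fun k => lead_coef (p k)).
have [Ip nsp minp] := HF _ (sI N); rewrite -/(p N) in Ip nsp minp.
have le_size k : (k < N)%N -> (size (p k) <= size (p N))%N.
  move=> ltk; have [_ _ -> //] := HF _ (sI k).
  move=> spk; apply: nsp => J idJ Js; apply: spk => // q /(sub_s _ _ (ltnW ltk)).
  exact: Js.
have pN0 : p N != 0.
  by apply/eqP => p0; apply: nsp; rewrite p0; case: (idspan (s N)).
set d := size (p N) in le_size minp.
(* The coefficients in the top degree of [p N], zero included, of span elements no longer than
   [p N]. Multiplying an earlier [p k] by a power of the variable puts its leading coefficient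
   here. *)
pose J b := exists q, [/\ span (s N) q, (size q <= d)%N & q`_d.-1 = b].
have idJ : ideal J.
  have [sp0 spD spM] := idspan (s N); split.
  - by exists 0; rewrite size_poly0 coef0.
  - move=> _ _ [q [spq szq <-]] [r [spr szr <-]]; exists (q + r).
    split; [exact: spD | | by rewrite coefD].
    by rewrite (leq_trans (size_polyD _ _)) // geq_max szq.
  - move=> b _ [q [spq szq <-]]; exists (b%:P * q); split; first exact: spM.
      by rewrite mul_polyC (leq_trans (size_scale_leq _ _)).
    by rewrite coefCM.
have [k ltk|q [spq szq qE]] := HN _ idJ.
  have lek := le_size _ ltk.
  have pk0 : p k != 0.
    have [_ nspk _] := HF _ (sI k).
    by apply/eqP => p0; apply: nspk; rewrite -/(p k) p0; case: (idspan (s k)).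
  exists (p k * 'X^(d - size (p k))); split.
  - move=> J' idJ' J's; rewrite mulrC; case: (idJ') => _ _; apply.
    by apply: J's; apply: ps.
  - by rewrite size_mulXn // subnK.
  - have s0 : (0 < size (p k))%N by rewrite size_poly_gt0.
    rewrite coefMXn lead_coefE ltnNge -subn1 leq_sub2l //=.
    by rewrite subnAC subKn // subn1.
(* Subtracting [q] stays in [I] and outside the span, yet cancels the top coefficient of [p N]. *)
have: (d <= size (p N - q)%R)%N.
  apply: minp.
    apply: idealB => //.
    by have idI' := idI; apply: spq => // r /sI.
  move=> spd; apply: nsp; rewrite -[p N](subrK q).
  by case: (idspan (s N)) => _ spD _; apply: spD.
have d0 : (0 < d)%N by rewrite size_poly_gt0.
apply/negP; rewrite -ltnNge -[d in (_ < d)%N](prednK d0) ltnS.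
apply/leq_sizeP => j; rewrite leq_eqVlt => /predU1P[<-|ltj].
  by rewrite coefB qE subrr.
by rewrite coefB !nth_default ?subr0 //; rewrite -?(prednK d0) ?(leq_trans szq) // -[leqLHS](prednK d0).
Qed.

Lemma noetherian_generates (B A : comNzRingType) (io : {rmorphism B -> A}) xs :
  generates io xs -> noetherian B -> noetherian A.
Proof.
elim: xs B io => [|x xs IHxs] B io gen noethB.
  exact: noetherian_surj (generates_nil gen) noethB.
exact: IHxs (generates_cons gen) (noetherian_poly noethB).
Qed.

(** * Extending points along finitely generated algebras *)

Lemma prime_idealX (A : comNzRingType) (J : A -> Prop) a k :
  prime_ideal J -> J (a ^+ k) -> J a.
Proof.
case=> _ J1 prJ; elim: k => [|k IHk]; first by rewrite expr0 => /J1.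
by rewrite exprS => /prJ [].
Qed.

Lemma ideal_sum (A : comNzRingType) (J : A -> Prop) (T : Type) (r : seq T)
    (P : pred T) (F : T -> A) :
  ideal J -> (forall i, P i -> J (F i)) -> J (\sum_(i <- r | P i) F i).
Proof. by case=> J0 JD _ JF; apply: big_ind. Qed.

Section OneVariable.

Variables (K : closedFieldType) (B : idomainType) (I : {poly B} -> Prop).
Hypothesis prI : prime_ideal I.

Let idI : ideal I. Proof. by case: prI. Qed.

(* JX is the extension of the contracted ideal, so that I = JX exactly when the
   variable is transcendental over B modulo the contraction of I. *)
Let JX (p : {poly B}) := forall i, I (p`_i)%:P.

Let JX_ideal : ideal JX.
Proof.
case: idI => I0 ID IM; split=> [i|p q Jp Jq i|p q Jq i].
- by rewrite coef0.
- by rewrite coefD polyCD; apply: ID.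
- rewrite coefM raddf_sum /=; apply: ideal_sum => // j _.
  by rewrite polyCM; apply: IM.
Qed.

Let JX_sub p : JX p -> I p.
Proof.
move=> Jp; rewrite -[p]coefK poly_def; apply: ideal_sum => // i _.
by rewrite -mul_polyC mulrC; case: idI => _ _; apply.
Qed.

Let minimal_outside (P : {poly B} -> Prop) G :=
  [/\ P G, ~ JX G & forall H, P H -> ~ JX H -> (size G <= size H)%N].

(** Otherwise the leading term is in [JX], and removing it leaves a shorter element of [P] still
    outside [JX]. *)
Let lead_coef_outside (P : {poly B} -> Prop) G :
  ideal P -> (forall p, I p -> P p) -> minimal_outside P G ->
  ~ I (lead_coef G)%:P.
Proof.
move=> idP IP [PG nJG minG] Ilc.
have G0 : G != 0 by apply/eqP => G0; apply: nJG; rewrite G0; case: JX_ideal.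
pose T := (lead_coef G)%:P * 'X^((size G).-1).
have JT : JX T.
  by rewrite /T mulrC; case: JX_ideal => _ _; apply=> i; rewrite coefC;
    case: ifP => // _; case: idI.
have lt_size : (size (G - T)%R < size G)%N.
  rewrite -[ltnRHS]prednK ?size_poly_gt0 // ltnS; apply/leq_sizeP => j.
  rewrite leq_eqVlt => /predU1P[<-|ltj].
    by rewrite coefB coefCM coefXn eqxx mulr1 subrr.
  rewrite coefB coefCM coefXn [j == _]gtn_eqF // mulr0 subr0 nth_default //.
  by rewrite -[leqLHS]prednK ?size_poly_gt0.
suff: (size G <= size (G - T)%R)%N by rewrite leqNgt lt_size.
apply: minG.
  by apply: idealB => //; apply/IP/JX_sub.
by move=> JGT; apply: nJG; rewrite -[G](subrK T); case: JX_ideal => _ JD _; apply: JD.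
Qed.

(** The remainder is in [P] and shorter than [G], so minimality of [G] forces it into [JX]. *)
Let pseudo_division (P : {poly B} -> Prop) G F :
  ideal P -> minimal_outside P G -> P F ->
  exists2 k, JX (F %% G) &
    lead_coef G ^+ k *: F = F %/ G * G + F %% G.
Proof.
move=> idP [PG nJG minG] PF.
have G0 : G != 0 by apply/eqP => G0; apply: nJG; rewrite G0; case: JX_ideal.
have E := Pdiv.Idomain.divp_eq F G; exists (scalp F G) => //.
apply: NNPP => nJ; have := minG (F %% G).
rewrite leqNgt Pdiv.Idomain.ltn_modp G0 => /(_ _ nJ) H.
suff: P (F %% G) by move/H.
have -> : F %% G = lead_coef G ^+ scalp F G *: F - F %/ G * G.
  by rewrite E addrC addKr.
apply: idealB => //; case: idP => _ _ PM; last exact: PM.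
by rewrite -mul_polyC; apply: PM.
Qed.

(* The elements G of minimal size outside JX in I + (a) are constants (pseudo-
   division by G, primality of I), which gives b = u a + v with v in I. *)
Lemma extend_point_one a : ~ I a ->
  exists2 b, ~ I b%:P & forall phi : {rmorphism B -> K},
    (forall c, I c%:P -> phi c = 0) -> phi b != 0 ->
    exists2 z, forall p, I p -> (map_poly phi p).[z] = 0
             & (map_poly phi a).[z] != 0.
Proof.
move=> nIa; have [I0 ID IM] := idI; have [_ _ prM] := prI.
(* Transcendental case: some coefficient of [a] is outside [I], and any non-root of the image of [a]
   will do. *)
case: (classic (forall F, I F -> JX F)) => [IJ|nIJ].
  have /not_all_ex_not [i nIai] : ~ JX a by move=> /JX_sub.
  exists a`_i => // phi phi0 nz; have nz_a : map_poly phi a != 0.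
    by apply: contraNneq nz => /(congr1 (fun p : {poly K} => p`_i)); rewrite coef_map coef0 => ->.
  have /closed_nonrootP [z nrz] := nz_a; exists z => // p /IJ Jp.
  suff -> : map_poly phi p = 0 by rewrite horner0.
  by apply/polyP => j; rewrite coef_map coef0; apply: phi0.
have [|F [[IF nJF] minF']] := @ex_minimal _ (fun F : {poly B} => size F) (fun F => I F /\ ~ JX F).
  have [F FP] := not_all_ex_not _ _ nIJ; exists F; exact: imply_to_and FP.
have minF : minimal_outside I F by split=> // H IH nJH; apply: minF'.
have nIF := lead_coef_outside idI (fun p Ip => Ip) minF.
pose P p := exists u v, I v /\ p = u * a + v.
have idP : ideal P.
  split.
  - by exists 0, 0; rewrite mul0r addr0.
  - move=> _ _ [u [v [Iv ->]]] [u' [v' [Iv' ->]]]; exists (u + u'), (v + v').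
    by split; [exact: ID | rewrite mulrDl addrACA].
  - move=> w _ [u [v [Iv ->]]]; exists (w * u), (w * v).
    by split; [exact: IM | rewrite mulrDr mulrA].
have IP p : I p -> P p by move=> Ip; exists 0, p; rewrite mul0r add0r.
have Pa : P a by exists 1, 0; rewrite mul1r addr0.
have [|G [[PG nJG] minG']] := @ex_minimal _ (fun F : {poly B} => size F) (fun F => P F /\ ~ JX F).
  by exists F; split=> //; apply: IP.
have minG : minimal_outside P G by split=> // H IH nJH; apply: minG'.
have nIG := lead_coef_outside idP IP minG.
have szF : (0 < size F)%N.
  by rewrite size_poly_gt0; apply/eqP => F0; apply: nIF; rewrite F0 lead_coef0.
have szG : (0 < size G)%N.
  by rewrite size_poly_gt0; apply/eqP => G0; apply: nIG; rewrite G0 lead_coef0.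
have nIlX k : ~ I (lead_coef G ^+ k)%:P.
  by rewrite rmorphXn => /(prime_idealX prI).
(* If [G] were not constant, dividing [a] by it would show that [G] is not in [I]. Dividing [F] by
   [G] then puts the quotient in [I]; it is shorter than [F], hence in [JX], and so is a multiple of
   [F] by a power of [lead_coef G], against [nIF]. *)
have sizeG : size G = 1.
  apply/eqP; apply: NNPP => /negP szG1.
  have szG2 : (1 < size G)%N by case: (size G) szG szG1 => [|[]].
  have nIGG : ~ I G.
    move=> IG; have [k Jr E] := pseudo_division idP minG Pa.
    have: I (lead_coef G ^+ k *: a).
      by rewrite E; apply: ID; [apply: IM | apply: JX_sub].
    by rewrite -mul_polyC => /prM [/nIlX|].
  have [k Jr E] := pseudo_division idP minG (IP _ IF).
  have: I (F %/ G * G).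
    have -> : F %/ G * G = lead_coef G ^+ k *: F - F %% G by rewrite E addrK.
    by apply: idealB; [|rewrite -mul_polyC; apply: IM | apply: JX_sub].
  case/prM => // Iq.
  have Jq : JX (F %/ G).
    apply: NNPP => nJq; have := minF' _ (conj Iq nJq); apply/negP; rewrite -ltnNge.
    rewrite Pdiv.Idomain.size_divp; last by rewrite -size_poly_gt0.
    by rewrite ltn_subrL szF andbT -ltnS prednK.
  have [_ JD JM] := JX_ideal.
  have: JX (lead_coef G ^+ k *: F) by rewrite E; apply: JD => //; rewrite mulrC; apply: JM.
  move/(_ (size F).-1); rewrite coefZ polyCM => /prM [/nIlX //|].
  exact: nIF.
have GE : G = (lead_coef G)%:P by rewrite lead_coefE sizeG; apply: size1_polyC; rewrite sizeG.
(* The factor from [F] keeps its image nonconstant, so that it has a root [z], and carries the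
   vanishing at [z] over to all of [I]; the factor from [G] keeps [a] nonzero at [z]. *)
exists (lead_coef G * lead_coef F); first by rewrite polyCM => /prM [].
move=> phi phi0; rewrite rmorphM mulf_eq0 negb_or => /andP [nzG nzF].
have /closed_rootP [z rz] : size (map_poly phi F) != 1.
  rewrite size_map_poly_id0 //; apply/eqP => szF1; apply: nIF.
  by rewrite lead_coefE szF1 /= -size1_polyC // szF1.
have I_z p : I p -> (map_poly phi p).[z] = 0.
  move=> Ip; have [k Jr /(congr1 (fun q => (map_poly phi q).[z]))] := pseudo_division idI minF Ip.
  rewrite rmorphD rmorphM /= linearZ /= hornerD hornerM hornerZ (rootP rz) mulr0.
  suff -> : map_poly phi (p %% F) = 0.
    rewrite horner0 addr0 => /eqP; rewrite mulf_eq0 rmorphXn expf_eq0 (negPf nzF) andbF.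
    by move/eqP.
  by apply/polyP => j; rewrite coef_map coef0; apply: phi0.
exists z => //; have [u [v [Iv]]] := PG.
rewrite {1}GE => /(congr1 (fun q => (map_poly phi q).[z])).
rewrite rmorphD rmorphM /= map_polyC hornerC hornerD hornerM (I_z v) // addr0 => E.
by apply: contraNneq nzG => az; rewrite /= in E; rewrite E az mulr0.
Qed.

End OneVariable.

(** Induction on the generators by [extend_point_one]: each step pulls the obstruction [b] back to a
    smaller base and extends [phi] by the value [z] of one more generator. *)
Lemma extend_point (K : closedFieldType) (B : idomainType) (A : comNzRingType)
    (io : {rmorphism B -> A}) (xs : seq A) (I : A -> Prop) a :
  generates io xs -> prime_ideal I -> ~ I a ->
  exists2 b, ~ I (io b) & forall phi : {rmorphism B -> K},
    (forall c, I (io c) -> phi c = 0) -> phi b != 0 ->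
    exists psi : A -> K,
      [/\ {morph psi : x y / x + y}, {morph psi : x y / x * y},
          forall c, psi (io c) = phi c, forall x, I x -> psi x = 0
        & psi a != 0].
Proof.
move=> gen prI nIa; elim: xs B io gen => [|x xs IHxs] B io gen.
  have surj := generates_nil gen; have [s sE] := choice _ surj.
  have [idI _ _] := prI; have [I0 _ _] := idI.
  exists (s a); rewrite ?sE // => phi phi0 nz; exists (fun x => phi (s x)).
  have sP x c : io c = x -> phi (s x) = phi c.
    move=> xE; apply/eqP; rewrite -subr_eq0 -rmorphB; apply/eqP/phi0.
    by rewrite rmorphB sE xE subrr.
  split=> //= [x y|x y|c|x Ix].
  - by rewrite -rmorphD; apply: sP; rewrite rmorphD !sE.
  - by rewrite -rmorphM; apply: sP; rewrite rmorphM !sE.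
  - exact: sP.
  - by apply: phi0; rewrite sE.
have [b' nIb' ext'] := IHxs _ _ (generates_cons gen).
have prI' := prime_ideal_preim (adjoin_morph io x) prI.
have [b nIb ext] := extend_point_one K prI' nIb'.
exists b; first by rewrite -(adjoin_morphC io x).
move=> phi phi0 nzb.
have [c Ic|z Iz nz] := ext phi _ nzb.
  by apply: phi0; rewrite -(adjoin_morphC io x).
have [psi [psiD psiM psiE psiI psia]] := ext' (adjoin_morph phi z) Iz nz.
exists psi; split=> // c.
by rewrite -(adjoin_morphC io x) psiE adjoin_morphC.
Qed.

(** * Closed sets and curves *)

Section ZariskiClosed.

Variables (K : fieldType) (n : nat).
Implicit Types (X Y Z : pt K n -> Prop) (p q : {mpoly K[n]}) (x : pt K n).

Lemma pevalD x : {morph (fun p => peval p x) : p q / p + q}.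
Proof. exact: mevalD. Qed.

Lemma pevalB x : {morph (fun p => peval p x) : p q / p - q}.
Proof. exact: mevalB. Qed.

Lemma pevalM x : {morph (fun p => peval p x) : p q / p * q}.
Proof. exact: mevalM. Qed.

Lemma pevalC c x : peval c%:MP x = c.
Proof. exact: mevalC. Qed.

Lemma pevalX i x : peval 'X_i x = x ord0 i.
Proof. exact: mevalXU. Qed.

(** Only constants have to be reached by [io], so that this serves for [mpolyC] as well as for
    [bivar f g]. *)
Lemma mpoly_generates (B : comNzRingType) (io : B -> {mpoly K[n]}) :
  (forall c, exists b, io b = c%:MP) -> generates io [seq 'X_i | i : 'I_n].
Proof.
move=> ioC S Sio SX SD SM p.
have SC c : S c%:MP by have [b <-] := ioC c.
elim/mpolyind: p => [|c m p _ _ Sp]; first by rewrite -mpolyC0.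
apply: SD => //; rewrite -mul_mpolyC; apply: (SM) => //.
rewrite mpolyXE_id; apply: big_ind => [|x y|i _]; [by rewrite -mpolyC1|exact: SM|].
elim: (m i) => [|k IHk]; first by rewrite expr0 -mpolyC1.
by rewrite exprS; apply: SM => //; apply: SX; apply: image_f.
Qed.

Lemma noetherian_mpoly : noetherian {mpoly K[n]}.
Proof.
apply: (@noetherian_generates K _ (@mpolyC n K)); last exact: noetherian_field.
by apply: mpoly_generates => c; exists c.
Qed.

Lemma vanishing_ideal X : ideal (vanishing X).
Proof.
split=> [x _|p q Ip Iq x Xx|p q Iq x Xx]; first by rewrite -mpolyC0 pevalC.
  by rewrite pevalD Ip // Iq // addr0.
by rewrite pevalM Iq // mulr0.
Qed.

Lemma zclosed_hypersurface p : zclosed (fun x => peval p x = 0).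
Proof.
by exists (fun q => q = p) => x; split=> [px q ->|]; last apply.
Qed.

Lemma zclosedI X Y : zclosed X -> zclosed Y -> zclosed (fun x => X x /\ Y x).
Proof.
move=> [S XS] [T YT]; exists (fun p => S p \/ T p) => x; split.
  by case=> /XS Sx /YT Tx p [/Sx|/Tx].
by move=> STx; split; [apply/XS|apply/YT] => p ?; apply: STx; [left|right].
Qed.

Lemma zclosed_point x : zclosed (fun y => y = x).
Proof.
exists (fun p => peval p x = 0) => y; split=> [-> //|xy].
apply/rowP => i; apply/eqP; rewrite -subr_eq0.
have := xy ('X_i - (x ord0 i)%:MP).
by rewrite !pevalB !pevalX !pevalC subrr => ->.
Qed.

Lemma zclosed_vanishing X x :
  zclosed X -> (forall p, vanishing X p -> peval p x = 0) -> X x.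
Proof.
by case=> S XS Ix; apply/XS => p Sp; apply: Ix => y /XS; apply.
Qed.

Lemma irreducible_point x : irreducible (fun y => y = x).
Proof.
split=> [||Y Z _ _ YZ]; [exact: zclosed_point|by exists x|].
by case: (YZ x) => // ?; [left|right] => _ ->.
Qed.

Lemma irreducible_prime X : irreducible X -> prime_ideal (vanishing X).
Proof.
case=> _ [x Xx] irr; split; first exact: vanishing_ideal.
  by move=> /(_ _ Xx) /eqP; rewrite -mpolyC1 pevalC oner_eq0.
move=> p q Ipq; apply: irr; try exact: zclosed_hypersurface.
by move=> y /Ipq /eqP; rewrite pevalM mulf_eq0 => /orP[] /eqP; [left|right].
Qed.

Definition finite_pts X := exists s : seq (pt K n), forall x, X x -> x \in s.

Lemma not_vanishing X p : ~ vanishing X p -> exists2 x, X x & peval p x != 0.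
Proof.
move=> nIp; apply: NNPP => no; apply: nIp => x Xx.
by apply/eqP; apply/negP => /negP px; apply: no; exists x.
Qed.

(** Without such a [Z], equations could be added to [X] forever, each not vanishing on the infinite
    set cut out so far; this contradicts noetherianity. *)
Lemma infinite_minimal X : zclosed X -> ~ finite_pts X ->
  exists Z, [/\ zclosed Z, subset_of Z X, ~ finite_pts Z &
    forall p, ~ vanishing Z p -> finite_pts (fun x => Z x /\ peval p x = 0)].
Proof.
move=> clX infX; apply: NNPP => no.
pose inZ (s : seq {mpoly K[n]}) x := X x /\ forall q, q \in s -> peval q x = 0.
have clZ s : zclosed (inZ s).
  elim: s => [|q s IHs]; first by case: clX => S XS; exists S => x; split=> [[/XS]|/XS].
  have [S HS] := zclosedI IHs (zclosed_hypersurface q); exists S => x.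
  split=> [[Xx qsx]|/HS [[Xx sx] qx]].
    apply/HS; split; last by apply: qsx; rewrite inE eqxx.
    by split=> // r rs; apply: qsx; rewrite inE rs orbT.
  by split=> // r; rewrite inE => /predU1P[-> //|/sx].
have next s : exists p, ~ finite_pts (inZ s) ->
    ~ vanishing (inZ s) p /\ ~ finite_pts (inZ (rcons s p)).
  case: (classic (finite_pts (inZ s))) => [fin|inf]; first by exists 0.
  apply: NNPP => no_p; apply: no; exists (inZ s); split=> // [x []//|p nIp].
  apply: NNPP => infp; apply: no_p; exists p => _; split=> // -[t Ht].
  apply: infp; exists t => x [[Xx sx] px]; apply: Ht; split=> // q.
  by rewrite mem_rcons inE => /predU1P[-> //|/sx].
have [F HF] := choice _ next.
pose s := fix s k := if k is k'.+1 then rcons (s k') (F (s k')) else [::].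
have infs k : ~ finite_pts (inZ (s k)).
  elim: k => [[t Ht]|k IHk]; last by have [] := HF _ IHk.
  by apply: infX; exists t => x Xx; apply: Ht.
have Fs j k : (j < k)%N -> F (s j) \in s k.
  elim: k => // k IHk; rewrite ltnS leq_eqVlt /= mem_rcons inE => /predU1P[->|/IHk ->].
    by rewrite eqxx.
  by rewrite orbT.
have [N HN] := noetherian_mpoly (fun k => F (s k)).
have [+ _] := HF _ (infs N); apply.
apply: (HN _ (vanishing_ideal (inZ (s N)))) => k ltk x [_ sx].
exact/sx/Fs.
Qed.

(** In a minimal [Z], a closed set not containing [Z] meets it in finitely many points, and two
    finite sets cannot cover [Z]. *)
Lemma infinite_irreducible X : zclosed X -> ~ finite_pts X ->
  exists Z, [/\ irreducible Z, subset_of Z X & ~ finite_pts Z].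
Proof.
move=> clX infX; have [Z [clZ ZX infZ minZ]] := infinite_minimal clX infX.
exists Z; split=> //; split=> //.
  apply: NNPP => no; apply: infZ; exists [::] => x Zx.
  by case: no; exists x.
move=> Y W [S YS] [T WT] ZYW; apply: NNPP => /not_or_and [nY nW].
have fin (V : pt K n -> Prop) U : (forall x, V x <-> zero_set U x) ->
    ~ subset_of Z V -> finite_pts (fun x => Z x /\ V x).
  move=> VU nV; have [x xV] := not_all_ex_not _ _ nV; have [Zx nVx] := imply_to_and _ _ xV.
  have [p pU] : exists p, ~ (U p -> peval p x = 0).
    by apply: not_all_ex_not => Ux; apply: nVx; apply/VU.
  have [Up px] := imply_to_and _ _ pU.
  have [|s Hs] := minZ p; first by move/(_ _ Zx).
  by exists s => y [Zy /VU Uy]; apply: Hs; split=> //; apply: Uy.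
have [s Hs] := fin _ _ YS nY; have [t Ht] := fin _ _ WT nW.
apply: infZ; exists (s ++ t) => x Zx; rewrite mem_cat.
by case: (ZYW _ Zx) => [Yx|Wx]; [rewrite Hs|rewrite Ht ?orbT].
Qed.

(** An infinite intersection would contain an infinite irreducible [Z], and a point, [Z] and [X]
    would form a chain too long for dimension one. *)
Lemma curve_hypersurface_finite X p : irreducible_curve X ->
  ~ vanishing X p -> finite_pts (fun x => X x /\ peval p x = 0).
Proof.
move=> [irrX [_ no_chain]] nIp; apply: NNPP => inf.
have clX : zclosed X by case: irrX.
have [|Z [irrZ ZX infZ]] := infinite_irreducible _ inf.
  exact/zclosedI/zclosed_hypersurface.
have [z Zz] : exists z, Z z by case: irrZ.
have [y Xy py] := not_vanishing nIp.
have [w [Zw wz]] : exists w, Z w /\ ~ w = z.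
  apply: NNPP => no; apply: infZ; exists [:: z] => w Zw; rewrite inE.
  by apply/eqP; apply: NNPP => wz; apply: no; exists w.
apply: no_chain.
exists (fun i => match i with 0 => fun x => x = z | 1 => Z | _ => X end); split.
  case=> [|[|i]] _; split=> //; first exact: irreducible_point.
    by move=> _ ->; have [] := ZX _ Zz.
  by move=> x /ZX [].
case=> [|[|//]] _; split; try by [move=> _ ->|move=> x /ZX []|exists w].
by exists y; split=> // /ZX [_ py0]; rewrite py0 eqxx in py.
Qed.

Lemma curve_not_point X x : irreducible_curve X -> exists2 y, X y & y <> x.
Proof.
move=> [_ [[Z [irrZ ltZ]] _]]; apply: NNPP => no.
have Xx y : X y -> y = x by move=> Xy; apply: NNPP => nyx; apply: no; exists y.
have [_ [y [Zy nZy]]] := ltZ 0 isT; have [[_ [z Zz] _] Z0X] := irrZ 0 isT.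
have [_ Z1X] := irrZ 1 isT; apply: nZy.
by rewrite (Xx _ (Z1X _ Zy)) -(Xx _ (Z0X _ Zz)).
Qed.

Lemma curve_nonconstant_coord X : irreducible_curve X ->
  exists i, forall c, ~ vanishing X ('X_i - c%:MP).
Proof.
move=> curX; apply: NNPP => no.
have [irrX _] := curX; have [_ [x Xx] _] := irrX.
have [y Xy] := curve_not_point x curX; apply; apply/rowP => i.
have [c Ic] : exists c, vanishing X ('X_i - c%:MP).
  by apply: NNPP => nc; apply: no; exists i => c Ic; apply: nc; exists c.
have coord z : X z -> z ord0 i = c.
  by move=> /Ic /eqP; rewrite pevalB pevalX pevalC subr_eq0 => /eqP.
by rewrite !coord.
Qed.

End ZariskiClosed.

(* The substitution Q |-> Q(f, g), with f for the inner variable. *)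
Definition bivar (K : fieldType) n (f g : {mpoly K[n]}) :
    {rmorphism {poly {poly K}} -> {mpoly K[n]}} :=
  adjoin_morph (adjoin_morph (@mpolyC n K) f) g.

Lemma curve_algebraic_dependence (K : closedFieldType) n (X : pt K n -> Prop)
    (f g : {mpoly K[n]}) :
  irreducible_curve X -> exists2 Q, Q != 0 & vanishing X (bivar f g Q).
Proof.
move=> curX; apply: NNPP => no; have [irrX _] := curX.
have inj Q : vanishing X (bivar f g Q) -> Q = 0.
  by move=> IQ; apply/eqP; apply: NNPP => /negP nQ; apply: no; exists Q.
have prI := irreducible_prime irrX.
have ioC (c : K) : bivar f g c%:P%:P = c%:MP by rewrite /bivar !adjoin_morphC.
have gen : generates (bivar f g) [seq 'X_i | i : 'I_n].
  by apply: mpoly_generates => c; exists c%:P%:P.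
have nI1 : ~ vanishing X 1 by case: prI.
have [b nIb ext] := extend_point K gen prI nI1.
have b0 : b != 0.
  by apply/eqP => b0; apply: nIb; rewrite b0 rmorph0; case: (vanishing_ideal X).
(* This [c] keeps [b] nonzero after specializing the inner variable; by injectivity [f - c] is
   outside the ideal, so only finitely many points [s] of [X] have [f = c]. *)
have /closed_nonrootP [c nrc] : lead_coef b != 0 by rewrite lead_coef_eq0.
have nIfc : ~ vanishing X (f - c%:MP).
  have -> : f - c%:MP = bivar f g ('X - c%:P)%:P.
    by rewrite /bivar adjoin_morphC rmorphB /= adjoin_morphX adjoin_morphC.
  by move=> /inj /eqP; rewrite polyC_eq0 polyXsubC_eq0.
have [s Hs] := curve_hypersurface_finite curX nIfc.
pose evc : {rmorphism {poly K} -> K} := horner_eval c.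
have mb0 : map_poly evc b != 0.
  by rewrite -lead_coef_eq0 lead_coef_map_eq.
(* A non-root [d] of this product avoids the values of [g] on [s], yet [(c, d)] still lifts to a
   point of [X]. *)
have : map_poly evc b * \prod_(x <- s) ('X - (peval g x)%:P) != 0.
  by rewrite mulf_neq0 // monic_neq0 // monic_prod_XsubC.
case/closed_nonrootP => d; rewrite rootM negb_or => /andP [nbd nsd].
have [||psi [psiD psiM psiE psiI _]] := ext (adjoin_morph evc d).
- by move=> Q /inj ->; rewrite rmorph0.
- exact: nbd.
pose x : pt K n := \row_i psi 'X_i.
have psi_ev p : psi p = peval p x.
  apply: (@mpoly_generates K n K (@mpolyC n K) _ (fun p => psi p = peval p x)).
  - by move=> a; exists a.
  - by move=> a; rewrite pevalC -ioC psiE !adjoin_morphC /evc /= /horner_eval hornerC.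
  - by move=> _ /imageP [i _ ->]; rewrite pevalX mxE.
  - by move=> a a' Ea Ea'; rewrite psiD pevalD Ea Ea'.
  - by move=> a a' Ea Ea'; rewrite psiM pevalM Ea Ea'.
have Xx : X x.
  by apply: zclosed_vanishing => [|p Ip]; [case: irrX | rewrite -psi_ev psiI].
have fx : peval f x = c.
  rewrite -psi_ev -[f](adjoin_morphX (@mpolyC n K)).
  rewrite -(adjoin_morphC (adjoin_morph (@mpolyC n K) f) g) psiE.
  by rewrite adjoin_morphC /evc /= /horner_eval hornerX.
have gx : peval g x = d.
  by rewrite -psi_ev -{1}[g](adjoin_morphX (adjoin_morph (@mpolyC n K) f)) psiE adjoin_morphX.
have xs : x \in s by apply: Hs; rewrite pevalB fx pevalC subrr.
case/negP: nsd; rewrite (big_rem x) //= gx rootM.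
by rewrite root_XsubC eqxx.
Qed.

(** * Normal frames along a curve *)

Lemma mderivXU (R : nzRingType) n (i j : 'I_n) :
  mderiv i ('X_j : {mpoly R[n]}) = (i == j)%:R.
Proof.
rewrite mderivX mnm1E eq_sym; case: eqP => [->|_]; last by rewrite scale0r.
by rewrite scale1r -{1}[U_(j)%MM]add0m addmK mpolyX0.
Qed.

(** The chain rule modulo the gradient of [f]. Leaving [w] unspecified allows two uses for [bivar]:
    the inner variable, with 0 in place of [f], then the outer one. *)
Lemma mderiv_adjoin (B : comNzRingType) (K : fieldType) n
    (io : {rmorphism B -> {mpoly K[n]}}) (f g : {mpoly K[n]}) :
  (forall b, exists w, forall i, mderiv i (io b) = w * mderiv i f) ->
  forall Q, exists w, forall i, mderiv i (adjoin_morph io g Q) =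
    adjoin_morph io g Q^`() * mderiv i g + w * mderiv i f.
Proof.
move=> dio; elim/poly_ind => [|Q b [w IHQ]].
  by exists 0 => i; rewrite deriv0 !rmorph0 mderiv0 !mul0r addr0.
have [v Hv] := dio b; exists (w * g + v) => i.
rewrite derivD derivM derivX derivC addr0 mulr1 !rmorphD !rmorphM /=.
rewrite !adjoin_morphX !adjoin_morphC mderivD mderivM IHQ Hv.
by ring.
Qed.

Lemma mderiv_bivar (K : fieldType) n (f g : {mpoly K[n]}) Q :
  exists w, forall i, mderiv i (bivar f g Q) =
    bivar f g Q^`() * mderiv i g + w * mderiv i f.
Proof.
apply: mderiv_adjoin => q.
have [|w Hw] := @mderiv_adjoin K K n (@mpolyC n K) 0 f _ q.
  by move=> b; exists 0 => i; rewrite mderivC mul0r.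
by exists (adjoin_morph (@mpolyC n K) f q^`()) => i; rewrite Hw mderiv0 mulr0 addr0.
Qed.

(** Take [Q] of minimal size. If its derivative also gave an element of the ideal, it would be 0,
    and in characteristic 0 [Q] would be a polynomial in [f] alone; that splits into factors
    [f - c], none in the prime ideal. *)
Lemma curve_separable_dependence (K : numClosedFieldType) n (X : pt K n -> Prop)
    (f g : {mpoly K[n]}) :
  irreducible_curve X -> (forall c, ~ vanishing X (f - c%:MP)) ->
  exists2 Q, vanishing X (bivar f g Q) & ~ vanishing X (bivar f g Q^`()).
Proof.
move=> curX ncf; have [irrX _] := curX; have prI := irreducible_prime irrX.
have [idI nI1 prM] := prI.
have nIC (c : K) : c != 0 -> ~ vanishing X c%:MP.
  move=> c0 Ic; apply: nI1; rewrite -mpolyC1 -(mulVf c0) mpolyCM.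
  by case: idI => _ _; apply.
have [|Q [[Q0 IQ] minQ]] := @ex_minimal _ (fun Q : {poly {poly K}} => size Q)
    (fun Q => Q != 0 /\ vanishing X (bivar f g Q)).
  by have [Q Q0 IQ] := curve_algebraic_dependence f g curX; exists Q.
exists Q => // IQ'.
have Q'0 : Q^`() = 0.
  apply/eqP; apply: NNPP => /negP nQ'; have := minQ _ (conj nQ' IQ').
  by rewrite leqNgt lt_size_deriv.
have QE : Q = (Q`_0)%:P.
  apply/polyP => -[|i]; rewrite coefC //=; apply/polyP => j; rewrite coef0.
  have /(congr1 (fun q : {poly K} => q`_j)) := coef_deriv Q i.
  rewrite Q'0 coef0 coefMn coef0 => /esym/eqP; rewrite mulrn_eq0 /=.
  by move/eqP.
set q := Q`_0 in QE; have q0 : q != 0.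
  by apply: contra_neq Q0 => q0; rewrite QE q0.
move: IQ; rewrite QE /bivar adjoin_morphC; set ev := adjoin_morph _ f.
have [r ->] := closed_field_poly_normal q.
rewrite -mul_polyC rmorphM /= adjoin_morphC => /prM [].
  by apply: nIC; rewrite lead_coef_eq0.
elim: r => [|c r IHr]; first by rewrite big_nil rmorph1.
rewrite big_cons rmorphM /= => /prM [|//].
by rewrite rmorphB /= adjoin_morphX adjoin_morphC; apply: ncf.
Qed.

Lemma grad_bivar_coord (K : fieldType) n (f : {mpoly K[n]}) (j : 'I_n) Q
    (x : pt K n) : exists w,
  grad (bivar f 'X_j Q) x =
    peval (bivar f 'X_j Q^`()) x *: delta_mx 0 j + w *: grad f x.
Proof.
have [w Hw] := mderiv_bivar f 'X_j Q; exists (peval w x).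
apply/rowP => i; rewrite !mxE Hw pevalD !pevalM mderivXU eqxx /=.
by congr (_ * _ + _); case: eqP => _; rewrite -?mpolyC1 -?mpolyC0 pevalC.
Qed.

(** Where [h], the product of the derivatives of the relations [Q j], is nonzero, every basis vector
    is a combination of a gradient from the ideal and [grad f]. *)
Lemma curve_frame (K : numClosedFieldType) n (X : pt K n -> Prop) f :
  irreducible_curve X -> (forall c, ~ vanishing X (f - c%:MP)) ->
  exists (ps : 'I_n -> {mpoly K[n]}) h,
    [/\ forall j, vanishing X (ps j), ~ vanishing X h &
        forall x, peval h x != 0 -> row_full (col_mx (jac ps x) (grad f x))].
Proof.
move=> curX ncf; have [irrX _] := curX.
have [idI nI1 prM] := irreducible_prime irrX.
have dep j : exists Q, vanishing X (bivar f 'X_j Q) /\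
    ~ vanishing X (bivar f 'X_j Q^`()).
  by have [Q] := curve_separable_dependence 'X_j curX ncf; exists Q.
have [Q HQ] := choice _ dep.
exists (fun j => bivar f 'X_j (Q j)), (\prod_j bivar f 'X_j (Q j)^`()); split.
- by move=> j; case: (HQ j).
- by apply: (big_ind (fun p => ~ vanishing X p)) => [|p q nIp nIq /prM [] //|j _]; [| case: (HQ j)].
move=> x hx; rewrite -sub1mx; apply/row_subP => j; rewrite row1.
have bx : peval (bivar f 'X_j (Q j)^`()) x != 0.
  by apply: contraNneq hx => bx; rewrite (bigD1 j) //= pevalM bx mul0r.
have [w E] := grad_bivar_coord f j (Q j) x.
rewrite -[delta_mx 0 j](scalerK bx) scalemx_sub //.
rewrite -[X in (X <= _)%MS](addrK (w *: grad f x)) -E -addsmxE.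
apply: addmx_sub; last by rewrite eqmx_opp scalemx_sub // addsmxSr.
apply: submx_trans (addsmxSl _ _); rewrite -[X in (X <= _)%MS](rowK (fun j => grad (bivar f 'X_j (Q j)) x)).
exact: row_sub.
Qed.

(* Differentiating at x shows that A i takes the value (d_i p)(x) at x. *)
Lemma mpoly_hadamard (K : fieldType) n (p : {mpoly K[n]}) (x : pt K n) :
  exists A : 'I_n -> {mpoly K[n]},
    p = (peval p x)%:MP + \sum_i A i * ('X_i - (x ord0 i)%:MP).
Proof.
move: p; apply: (@mpoly_generates K n K (@mpolyC n K)) => [c|b|_ /imageP[i _ ->]|p q|p q].
- by exists c.
- by exists (fun=> 0); rewrite pevalC big1 ?addr0 // => i _; rewrite mul0r.
- exists (fun j => (j == i)%:R); rewrite pevalX (bigD1 i) //= eqxx mul1r.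
  rewrite big1 => [|j /negPf ->]; last by rewrite mul0r.
  by rewrite addr0 addrC subrK.
- move=> [A pE] [B qE]; exists (fun i => A i + B i).
  rewrite {1}pE {1}qE pevalD mpolyCD addrACA -big_split; congr (_ + _).
  by apply: eq_bigr => i _; rewrite mulrDl.
move=> [A pE] [B qE]; exists (fun i => A i * q + (peval p x)%:MP * B i).
under eq_bigr do rewrite mulrDl.
rewrite big_split /= addrCA.
under [X in _ + (_ + X)]eq_bigr do rewrite -mulrA.
rewrite -mulr_sumr pevalM mpolyCM -mulrDr -qE.
under eq_bigr do rewrite mulrAC.
by rewrite -mulr_suml -mulrDl addrC -pE.
Qed.

(** Write the [ps j] as combinations of the ['X_i - x_i]; at [x] the coefficients form the Jacobian.
    For an invertible square block [M], the adjugate puts each [\det M * ('X_i - x_i)] in the ideal,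
    while [\det M] is nonzero at [x]. *)
Lemma jac_full_point (K : fieldType) n (X : pt K n -> Prop) k
    (ps : 'I_k -> {mpoly K[n]}) x :
  irreducible X -> X x -> (forall j, vanishing X (ps j)) ->
  row_full (jac ps x) -> forall y, X y -> y = x.
Proof.
move=> irrX Xx Ips full y Xy.
have [idI _ prM] := irreducible_prime irrX.
have [A HA] := choice _ (fun j => mpoly_hadamard (ps j) x).
pose d i : {mpoly K[n]} := 'X_i - (x ord0 i)%:MP.
have d0 i : peval (d i) x = 0 by rewrite pevalB pevalX pevalC subrr.
have psE j : ps j = \sum_i A j i * d i.
  by rewrite {1}[ps j]HA Ips // mpolyC0 add0r.
pose M := \matrix_(i, l) A (fullrankfun full i) l.
have evM : map_mx (meval (fun i => x ord0 i)) M = rowsub (fullrankfun full) (jac ps x).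
  apply/matrixP => i l; rewrite !mxE -/(peval _ x) psE raddf_sum /=.
  rewrite /peval raddf_sum (bigD1 l) //= -!/(peval _ x) mderivM pevalD !pevalM d0 mulr0 add0r.
  rewrite mderivB mderivXU mderivC eqxx subr0 -mpolyC1 pevalC mulr1.
  rewrite big1 ?addr0 // => m nml; rewrite -!/(peval _ x) mderivM pevalD !pevalM d0 mulr0 add0r.
  rewrite mderivB mderivXU mderivC eq_sym (negPf nml) subr0 mulr0n.
  by rewrite -mpolyC0 pevalC mulr0.
have nIdet : ~ vanishing X (\det M).
  move/(_ _ Xx)/eqP; rewrite /peval -det_map_mx evM; apply/negP.
  by rewrite -unitfE -unitmxE -row_full_unit fullrowsub_full.
have IMd i : vanishing X (\det M * d i).
  have /(congr1 (fun N => N *m (\col_l d l))) := mul_adj_mx M.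
  rewrite -mulmxA mul_scalar_mx => /matrixP /(_ i ord0); rewrite !mxE => <-.
  apply: ideal_sum => // l _; case: idI => _ _; apply.
  rewrite !mxE; under eq_bigr do rewrite !mxE.
  by rewrite -psE; apply: Ips.
apply/rowP => i; have := IMd i; case/prM => // /(_ _ Xy) /eqP.
by rewrite pevalB pevalX pevalC subr_eq0 => /eqP.
Qed.

(** * The ED correspondence *)

Section Regular.

Variables (K : numClosedFieldType) (n : nat) (X : pt K n -> Prop).
Hypothesis curX : irreducible_curve X.

Let irrX : irreducible X. Proof. by case: curX. Qed.

Let n_gt0 : (0 < n)%N.
Proof. by have [[i lti] _] := curve_nonconstant_coord curX; apply: leq_trans lti. Qed.

Lemma jac_not_full k (ps : 'I_k -> {mpoly K[n]}) x :
  X x -> (forall j, vanishing X (ps j)) -> ~~ row_full (jac ps x).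
Proof.
move=> Xx Ips; apply/negP => full; have [y Xy] := curve_not_point x curX.
by apply; apply: (jac_full_point irrX Xx Ips full).
Qed.

Lemma jac_rank k (ps : 'I_k -> {mpoly K[n]}) x :
  X x -> (forall j, vanishing X (ps j)) -> (\rank (jac ps x) <= n - 1)%N.
Proof.
move=> Xx Ips; have := jac_not_full Xx Ips.
by rewrite /row_full -ltnS subn1 prednK // ltn_neqAle rank_leq_col andbT.
Qed.

(** One extra row raises the rank by at most one, so the Jacobian already has rank [n - 1]. *)
Lemma frame_regular k (ps : 'I_k -> {mpoly K[n]}) x v :
  X x -> (forall j, vanishing X (ps j)) ->
  row_full (col_mx (jac ps x) (v : 'rV_n)) -> regular_pt X x.
Proof.
move=> Xx Ips full; split=> //; exists 1; split; first by case: curX.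
split; last by move=> l qs; apply: jac_rank.
exists k, ps; split=> //; apply/eqP; rewrite eqn_leq jac_rank //=.
have /eqP fullE := full; rewrite leq_subLR addnC -[leqLHS]fullE -addsmxE.
apply: leq_trans (mxrank_adds_leqif _ _) _.
by rewrite leq_add2l rank_leq_row.
Qed.

(** Joining [ps] to polynomials witnessing that [v] is normal would give a full Jacobian. *)
Lemma normal_not_frame k (ps : 'I_k -> {mpoly K[n]}) x v :
  X x -> (forall j, vanishing X (ps j)) -> normal_at X x v ->
  ~~ row_full (col_mx (jac ps x) v).
Proof.
move=> Xx Ips [l [qs [Iqs vqs]]].
pose rs i := match split i with inl j => ps j | inr j => qs j end.
have Irs i : vanishing X (rs i) by rewrite /rs; case: split => j.
apply: contra (jac_not_full Xx Irs); rewrite -!sub1mx => /submx_trans; apply.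
have -> : jac rs x = col_mx (jac ps x) (jac qs x).
  by apply/matrixP => i j; rewrite mxE [RHS]mxE /rs; case: split => m; rewrite !mxE.
rewrite -!addsmxE addsmx_sub addsmxSl /=.
exact: submx_trans vqs (addsmxSr _ _).
Qed.

Definition left_poly (p : {mpoly K[n]}) : {mpoly K[n + n]} :=
  p \mPo [tuple 'X_(lshift n i) | i < n].

Lemma peval_left_poly p x u : peval (left_poly p) (row_mx x u) = peval p x.
Proof.
rewrite /peval /left_poly comp_mpoly_meval; apply: meval_eq => i.
by rewrite tnth_mktuple mevalXU row_mxEl.
Qed.

Lemma ED_fiber_sub u : subset_of (ED_fiber X u) X.
Proof.
move=> x Ex; apply: zclosed_vanishing => [|p Ip]; first by case: irrX.
rewrite -(peval_left_poly p x u); apply: Ex => _ [y [v [-> [[Xy _] _]]]].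
by rewrite peval_left_poly Ip.
Qed.

(** A maximal minor nonzero at [(x, u)] is a polynomial in both points; it vanishes on the regular
    normal pairs, hence on their closure. *)
Lemma ED_not_frame k (ps : 'I_k -> {mpoly K[n]}) x u :
  (forall j, vanishing X (ps j)) -> ED_fiber X u x ->
  ~~ row_full (col_mx (jac ps x) (u - x)).
Proof.
move=> Ips Ex; apply/negP => full; pose g := fullrankfun full.
pose M : 'M[{mpoly K[n + n]}]_(k + 1, n) :=
  col_mx (\matrix_(j, i) left_poly ((ps j)^`M(i)))
         (\row_i ('X_(rshift n i) - 'X_(lshift n i))).
have evM y v : map_mx (meval (fun i => (row_mx y v) ord0 i)) (rowsub g M) =
    rowsub g (col_mx (jac ps y) (v - y)).
  apply/matrixP => i j; rewrite !mxE; case: split => m; rewrite !mxE.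
    exact: peval_left_poly.
  by rewrite [m]ord1 mevalB !mevalXU row_mxEl row_mxEr.
have evD y v : peval (\det (rowsub g M)) (row_mx y v) =
    \det (rowsub g (col_mx (jac ps y) (v - y))).
  by rewrite /peval -det_map_mx evM.
have: \det (rowsub g (col_mx (jac ps x) (u - x))) != 0.
  by rewrite -unitfE -unitmxE -row_full_unit fullrowsub_full.
case/eqP; rewrite -evD; apply: Ex => _ [y [v [-> [[Xy _] Nv]]]].
rewrite evD; apply/eqP; apply: contraNT (normal_not_frame Xy Ips Nv).
rewrite -unitfE -unitmxE -row_full_unit -!sub1mx => /submx_trans; apply.
exact: rowsub_sub.
Qed.

(** If [Z 1] were smaller than [X], adding [X] to the chain would give dimension at least two. *)
Lemma Sigma_fiber u : Sigma_inf X u -> subset_of X (ED_fiber X u).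
Proof.
move=> [Z [irrZ ltZ]]; have [_ [_ nch2]] := curX.
have ZX i : (i <= 1)%N -> subset_of (Z i) X.
  by move=> lei x Zx; have [_ ZE] := irrZ _ lei; apply/ED_fiber_sub/ZE.
suff XZ : subset_of X (Z 1) by move=> x /XZ; have [_] := irrZ 1 isT; apply.
move=> x Xx; apply: NNPP => nZx; apply: nch2.
exists (fun i => if (i <= 1)%N then Z i else X); split=> i lei.
  case: ifP => le1; last by split.
  by split; [case: (irrZ i le1) | apply: ZX].
case: i lei => [|[|//]] _; first exact: ltZ.
by split; [apply: ZX | exists x].
Qed.

(** * Squared distance functions and hyperspheres *)

Definition sqdist (u : pt K n) : {mpoly K[n]} :=
  \sum_i ('X_i - (u ord0 i)%:MP) ^+ 2.

Lemma peval_sqdist u x : peval (sqdist u) x = dotp (x - u) (x - u).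
Proof.
rewrite /peval /sqdist raddf_sum; apply: eq_bigr => i _ /=.
by rewrite expr2 mevalM mevalB mevalXU mevalC !mxE.
Qed.

Lemma grad_sqdist u c x : grad (sqdist u - c%:MP) x = 2 *: (x - u).
Proof.
apply/rowP => i; rewrite !mxE mderivB mderivC subr0 raddf_sum /=.
rewrite /peval raddf_sum (bigD1 i) //= big1 => [|j nji] /=.
  rewrite expr2 mderivM mderivB mderivXU mderivC eqxx subr0 mul1r mulr1.
  by rewrite addr0 mevalD mevalB mevalXU mevalC mulr_natl mulr2n.
rewrite expr2 mderivM mderivB mderivXU mderivC eq_sym (negPf nji) subr0.
by rewrite mulr0n mul0r mulr0 addr0 meval0.
Qed.

Lemma vanishing_sqdist u c :
  vanishing X (sqdist u - c%:MP) <-> in_hypersphere X u c.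
Proof.
have E x : peval (sqdist u - c%:MP) x = dotp (x - u) (x - u) - c.
  by rewrite pevalB pevalC peval_sqdist.
split=> H x Xx; first by apply/eqP; rewrite -subr_eq0 -E H.
by rewrite E H // subrr.
Qed.

(** Were [sqdist u] nonconstant on [X], its gradient, a multiple of [u - x], would complete a frame
    at a generic point of the fiber. *)
Lemma Sigma_hypersphere u : Sigma_inf X u -> exists c, in_hypersphere X u c.
Proof.
move=> /Sigma_fiber XE; apply: NNPP => no.
have ncf c : ~ vanishing X (sqdist u - c%:MP).
  by move/vanishing_sqdist => Hc; apply: no; exists c.
have [ps [h [Ips nIh frame]]] := curve_frame curX ncf.
have [x Xx hx] := not_vanishing nIh.
have := ED_not_frame Ips (XE _ Xx); apply/negP; rewrite negbK.
move: (frame _ hx); rewrite -!sub1mx => /submx_trans; apply.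
rewrite -!addsmxE addsmx_sub addsmxSl /=.
have -> : grad (sqdist u) x = - 2 *: (u - x).
  by rewrite -[sqdist u]subr0 -mpolyC0 grad_sqdist scaleNr -scalerN opprB.
exact: scalemx_sub (addsmxSr _ _).
Qed.

(** Here [u - x] is a multiple of a gradient from the ideal, so it is normal at every point of [X].
    Density of regular points then puts all of [X] in the fiber. *)
Lemma hypersphere_Sigma u c : in_hypersphere X u c -> Sigma_inf X u.
Proof.
move/vanishing_sqdist => Iu; have [_ [chX _]] := curX.
suff XE : subset_of X (ED_fiber X u).
  have [Z [irrZ ltZ]] := chX; exists Z; split=> // i /irrZ [? ZX].
  by split=> // x /ZX /XE.
have [i ncX] := curve_nonconstant_coord curX.
have [ps [h [Ips nIh frame]]] := curve_frame curX ncX.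
have [_ _ prM] := irreducible_prime irrX.
move=> x Xx p Ip.
(* The restriction of [p] to the slice over [u]. It vanishes on [X] where [h] is nonzero, and
   primality removes the factor [h]. *)
pose fib : {mpoly K[n]} := p \mPo [tuple (match split i with
  inl j => 'X_j | inr j => (u ord0 j)%:MP end) | i < n + n].
have fibE y : peval fib y = peval p (row_mx y u).
  rewrite /peval /fib comp_mpoly_meval; apply: meval_eq => j.
  rewrite tnth_mktuple [RHS]mxE; case: split => m.
    by rewrite mevalXU.
  by rewrite mevalC.
rewrite -fibE; have: vanishing X (h * fib).
  move=> y Xy; rewrite pevalM; have [-> | hy] := eqVneq (peval h y) 0; first by rewrite mul0r.
  rewrite fibE Ip ?mulr0 //; exists y, u; split=> //; split.
    exact: frame_regular Xy Ips (frame _ hy).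
  exists 1, (fun=> sqdist u - c%:MP); split=> //.
  have -> : u - y = - 2^-1 *: grad (sqdist u - c%:MP) y.
    rewrite grad_sqdist scalerA mulNr mulVf ?pnatr_eq0 //.
    by rewrite scaleN1r opprB.
  apply: scalemx_sub; rewrite -[X in (X <= _)%MS](@rowK _ 1 _ (fun=> grad (sqdist u - c%:MP) y) ord0).
  exact: row_sub.
by case/prM => // /(_ _ Xx).
Qed.

End Regular.

(** * The bilinear form and the normal space of an affine hull *)

Section Dot.

Variables (K : fieldType) (n : nat).
Implicit Types (x y v : pt K n).

Lemma dotpBr y v w : dotp y (v - w) = dotp y v - dotp y w :> K.
Proof. by rewrite /dotp -sumrB; apply: eq_bigr => i _; rewrite !mxE mulrBr. Qed.

Lemma dotp_shift x c y : dotp (x - (c + y)) (x - (c + y)) =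
  dotp (x - c) (x - c) - 2 * dotp y (x - c) + dotp y y.
Proof.
rewrite /dotp mulr_sumr -sumrB -big_split; apply: eq_bigr => i _ /=.
by rewrite !mxE; ring.
Qed.

Lemma affine_subspace_level y k : affine_subspace (fun v => dotp y v = k).
Proof.
move=> m v t yv t1.
have -> : dotp y (\sum_j t j *: v j) = \sum_j t j * dotp y (v j).
  under [RHS]eq_bigr do rewrite /dotp mulr_sumr.
  rewrite exchange_big; apply: eq_bigr => i _; rewrite summxE mulr_sumr.
  by apply: eq_bigr => j _; rewrite !mxE mulrCA.
by under eq_bigr do rewrite yv; rewrite -mulr_suml t1 mul1r.
Qed.

(** Each level set of [dotp y] is affine, so one containing [X] contains its hull. *)
Lemma normal_affine_hull (X : pt K n -> Prop) y :
  normal_space (affine_hull X) y <->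
  forall x x', X x -> X x' -> dotp y (x - x') = 0.
Proof.
split=> [Ny x x' Xx Xx'|Hy v v' hv hv'].
  by apply: Ny => A _ XA; apply: XA.
have [[x0 X0]|no] := classic (exists x, X x); last first.
  (* The hull of the empty set is empty: a combination of no points has coefficient sum 0, not 1. *)
  case: (hv (fun=> False)) => [m w t Aw t1 | x Xx]; last by apply: no; exists x.
  case: m w t Aw t1 => [|m] w t Aw; last by case: (Aw ord0).
  by rewrite big_ord0 => /esym/eqP; rewrite oner_eq0.
have level z : affine_hull X z -> dotp y z = dotp y x0.
  move/(_ (fun v => dotp y v = dotp y x0)); apply; first exact: affine_subspace_level.
  by move=> x Xx; apply/eqP; rewrite -subr_eq0 -dotpBr Hy.
by rewrite dotpBr !level // subrr.
Qed.

End Dot.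

Theorem mainTheorem13 (R : realType) (n : nat) (X : pt R[i] n -> Prop) :
  irreducible_curve X ->
  ((~ exists (c : pt R[i] n) (r : R[i]), in_hypersphere X c r) ->
      forall u : pt R[i] n, ~ Sigma_inf X u) /\
  (forall (c : pt R[i] n) (r : R[i]), in_hypersphere X c r ->
      forall u : pt R[i] n,
        Sigma_inf X u <-> exists y, normal_space (affine_hull X) y /\ u = c + y).
Proof.
move=> curX; split=> [no u /(Sigma_hypersphere curX) [r Hr]|c r Hc u].
  by apply: no; exists u, r.
split=> [/(Sigma_hypersphere curX) [r' Hr'] | [y [/normal_affine_hull Ny ->]]].
  exists (u - c); split; last by rewrite addrC subrK.
  (* Subtracting the equations of the two spheres leaves an affine equation, so [dotp (u - c)] is
     constant on [X]. *)
  have E x : X x -> 2 * dotp (u - c) (x - c) = r - r' + dotp (u - c) (u - c).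
    move=> Xx; have := dotp_shift x c (u - c).
    rewrite [c + _]addrC subrK Hr' // Hc // => ->; ring.
  apply/normal_affine_hull => x x' Xx Xx'.
  have -> : x - x' = (x - c) - (x' - c) by rewrite opprB addrA subrK.
  rewrite dotpBr; apply/eqP; rewrite subr_eq0; apply/eqP.
  by apply: (@mulfI _ 2); rewrite ?pnatr_eq0 // !E.
have [[_ [x0 X0] _] _] := curX.
(* The value given by [dotp_shift] at [x0]; it is the same at every point of [X] because [dotp y] is
   constant there. *)
apply: (hypersphere_Sigma curX (c := r - 2 * dotp y (x0 - c) + dotp y y)).
move=> x Xx; have E : dotp y (x - c) = dotp y (x0 - c).
  by apply/eqP; rewrite -subr_eq0 -dotpBr opprB addrA subrK Ny.
by rewrite dotp_shift E Hc.
Qed.
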